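(* Let $b\ge3$, $d\ge1$, and let $a_1,\dots,a_{d-1}$ be positive integers coprime to $b$. For every $t\in\mathbb{Z}$, \[\frac{1}{\phi(b)}\sum_{\substack{1\le m\le b-1\\ \gcd(m,b)=1}}S_{(a_1,\dots,a_{d-1},m;b)}(t)=\frac12 S_{(a_1,\dots,a_{d-1};b)}(t),\] and \[\left(\frac{1}{\phi(b)}\right)^d\sum_{\substack{1\le m_1,\dots,m_d\le b-1\\ \gcd(m_i,b)=1}}S_{(m_1,\dots,m_d;b)}(t)=\frac{1}{2^d}S_b(t)=\frac{\delta_{\mathbb{Z}}(t/b)-\frac1b}{2^d}.\]
   Context: $\phi$ is Euler's totient function, $\xi_b=e^{2\pi i/b}$, $S_{(c_1,\dots,c_k;b)}(n)=\frac1b\sum_{j=1}^{b-1}\frac{\xi_b^{jn}}{(1-\xi_b^{jc_1})\cdots(1-\xi_b^{jc_k})}$, and for $k=0$ this is $S_b(n)=\frac1b\sum_{j=1}^{b-1}\xi_b^{jn}$. $\delta_{\mathbb{Z}}(x)=1$ if $x\in\mathbb{Z}$ and $0$ otherwise. *)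

(* Defs.v *)
From HB Require Import structures.
From mathcomp Require Import all_boot all_order all_algebra.
From mathcomp Require Import reals sequences exp trigo.
From mathcomp Require Import complex.

Set Implicit Arguments.
Unset Strict Implicit.
Unset Printing Implicit Defensive.

Import Order.TTheory GRing.Theory Num.Theory.

Local Open Scope ring_scope.
Local Open Scope complex_scope.

(* The complex exponential, e^(x + iy) = e^x (cos y + i sin y). *)
Definition cexp (R : realType) (z : R[i]) : R[i] :=
  (expR (complex.Re z))%:C * (cos (complex.Im z) +i* sin (complex.Im z)).

Definition xi (R : realType) (b : nat) : R[i] :=
  cexp (0 +i* (2 * pi / b%:R)).

(* [fdsum R c b n] is the Fourier-Dedekind sum S_{(c_1,...,c_k;b)}(n) with
   c = [:: c_1; ...; c_k].  The product over c = [::] is 1, so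
   [fdsum R [::] b n] is S_b(n).  Since 0^-1 = 0 here, the definition is
   meaningful only when every c_i is coprime to b. *)
Definition fdsum (R : realType) (c : seq nat) (b : nat) (n : int) : R[i] :=
  b%:R^-1 * \sum_(1 <= j < b)
    (xi R b ^ (j%:Z * n) / \prod_(ci <- c) (1 - xi R b ^+ (j * ci))).

Definition deltaZ (R : realType) (x : R) : R[i] :=
  if x \is a Num.int then 1 else 0.

(* Main.v *)
(** Since xi is a primitive b-th root of unity, 1/(1 - z) + 1/(1 - z^-1) = 1 for
    z = xi^(jm) whenever 0 < j < b and m is coprime to b.  Pairing m with b - m,
    the factors 1/(1 - xi^(jm)) average to 1/2 over the m coprime to b,
    independently of j; exchanging the sums over j and over the m_i gives both
    averages, and S_b(t) is a geometric sum. *)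
Require Import Defs.
From mathcomp Require Import all_boot all_order all_algebra.
From mathcomp Require Import reals sequences exp trigo.
From mathcomp Require Import complex.
Import Order.TTheory GRing.Theory Num.Theory.
Local Open Scope ring_scope.
Local Open Scope complex_scope.

Lemma invf_1sub_add_inv (F : fieldType) (z : F) :
  z != 0 -> z != 1 -> (1 - z)^-1 + (1 - z^-1)^-1 = 1.
Proof.
move=> z0 z1.
have z1' : 1 - z != 0 by rewrite subr_eq0 eq_sym.
have -> : 1 - z^-1 = - ((1 - z) / z) by rewrite mulrBl mul1r divff // opprB.
by rewrite invrN invf_div -[X in X - _]mul1r -mulrBl divff.
Qed.

(** Kept in doubled form, so that nothing has to be divided by 2 in a field of arbitrary
    characteristic: the sum is added to its own reversal. *)
Lemma sum_inv_coprime (F : fieldType) (b j : nat) (z : F) :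
  b.-primitive_root z -> (1 < b)%N -> ~~ (b %| j)%N ->
  (\sum_(1 <= m < b | coprime m b) (1 - z ^+ (j * m))^-1) *+ 2
  = (totient b)%:R.
Proof.
move=> zP b1 bj.
have -> : (totient b)%:R = \sum_(1 <= m < b | coprime m b) (1 : F).
  (* The totient counts from index 0, which drops out because gcd(0, b) = b > 1. *)
  rewrite totient_count_coprime big_ltn ?(ltnW b1) //.
  rewrite {1}/coprime gcdn0 gtn_eqF // add0n natr_sum [RHS]big_mkcond /=.
  by apply: eq_bigr => m _; rewrite coprime_sym; case: coprime.
(* Reversal turns m into [1 + b - m.+1], that is b - m. The coprimality conditions become filters on
   the index lists, to be identified before the two sums are merged. *)
rewrite mulr2n {2}big_nat_rev /= -[X in _ + X]big_filter.
rewrite -[X in X + _]big_filter.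
have -> : [seq i <- index_iota 1 b | coprime (1 + b - i.+1) b]
          = [seq i <- index_iota 1 b | coprime i b].
  apply: eq_in_filter => i; rewrite mem_index_iota => /andP[_ ib].
  rewrite add1n subSS /coprime -[X in gcdn _ X](subnK (ltnW ib)).
  by rewrite gcdnDl -[X in _ = (gcdn i X == _)](subnK (ltnW ib)) gcdnDr gcdnC.
rewrite -big_split /= !big_filter.
rewrite [LHS]big_nat_cond [RHS]big_nat_cond.
apply: eq_bigr => m /andP[/andP[m1 mb] cmb]; rewrite add1n subSS.
have zN0 k : z ^+ k != 0.
  by rewrite expf_neq0 // (prim_root_eq0 zP) gtn_eqF // ltnW.
have -> : z ^+ (j * (b - m)) = (z ^+ (j * m))^-1.
  apply: (mulIf (zN0 (j * m)%N)); rewrite mulVf // -exprD -mulnDr.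
  by rewrite subnK ?(ltnW mb) // mulnC exprM (prim_expr_order zP) expr1n.
apply: invf_1sub_add_inv => //.
(* As m is coprime to b, b divides j * m only if it divides j. *)
by rewrite -(prim_order_dvd zP) Gauss_dvdl // coprime_sym.
Qed.

(** Distributivity, by induction on d: a tuple of length d + 1 splits into its head and its tail. *)
Lemma sum_tuple_prod (A : comNzRingType) (I : finType) (d : nat)
    (P : pred I) (f : I -> A) :
  \sum_(m : d.-tuple I | [forall i, P (tnth m i)]) \prod_(x <- m) f x
  = (\sum_(x | P x) f x) ^+ d.
Proof.
elim: d => [|d IHd].
  rewrite (big_pred1 [tuple]) ?big_nil ?expr0 // => m.
  by rewrite (tuple0 m) [RHS]eqxx; apply/forallP => -[].
have eall n (m : n.-tuple I) : [forall i, P (tnth m i)] = all P m.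
  by apply/forallP/all_tnthP.
rewrite exprS mulr_suml.
under [RHS]eq_bigr do rewrite -IHd mulr_sumr.
rewrite pair_big /=.
rewrite (reindex (fun p : I * d.-tuple I => [tuple of p.1 :: p.2])) /=.
  apply: eq_big => [[x m]|[x m] _] /=; first by rewrite !eall.
  by rewrite big_cons.
exists (fun m : d.+1.-tuple I => (thead m, [tuple of behead m])) => /=.
  by move=> [x m] _ /=; rewrite theadE; congr pair; apply: val_inj.
by move=> m _; rewrite -tuple_eta.
Qed.

Lemma prim_root_expz_eq1 (F : fieldType) (b : nat) (z : F) (t : int) :
  b.-primitive_root z -> (z ^ t == 1) = (b%:Z %| t)%Z.
Proof.
move=> zP; rewrite dvdzE; case: t => n; rewrite ?NegzE /=.
  by rewrite -exprnP (prim_order_dvd zP).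
by rewrite -exprnN invr_eq1 (prim_order_dvd zP).
Qed.

Lemma sum_prim_root_expz (F : fieldType) (b : nat) (z : F) (t : int) :
  b.-primitive_root z ->
  \sum_(0 <= j < b) z ^ (j%:Z * t) = if (b%:Z %| t)%Z then b%:R else 0.
Proof.
move=> zP.
have -> : \sum_(0 <= j < b) z ^ (j%:Z * t) = \sum_(j < b) (z ^ t) ^+ j.
  by rewrite big_mkord; apply: eq_bigr => j _; rewrite mulrC -exprz_exp.
rewrite -(prim_root_expz_eq1 _ _ _ t zP).
case: eqP => [->|/eqP/negbTE zt].
  by under eq_bigr do rewrite expr1n; rewrite sumr_const card_ord.
(* With w = z^t, the sum times w - 1 is w^b - 1 = 0, while w is not 1. *)
have /eqP := subrX1 (z ^ t) b.
rewrite exprnP exprzAC -exprnP (prim_expr_order zP) exp1rz subrr eq_sym mulf_eq0.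
by rewrite subr_eq0 zt => /eqP.
Qed.

Lemma cos_sin_expr (R : realType) (x : R) (k : nat) :
  (cos x +i* sin x) ^+ k = cos (x *+ k) +i* sin (x *+ k).
Proof.
elim: k => [|k IHk]; first by rewrite expr0 !mulr0n cos0 sin0.
rewrite exprS IHk mulrS cosD sinD; apply/eqP; rewrite eq_complex /=.
by rewrite eqxx /= addrC.
Qed.

Lemma prim_root_xi (R : realType) (b : nat) :
  (0 < b)%N -> b.-primitive_root (xi R b).
Proof.
move=> b0; have bR : (b%:R : R) != 0 by rewrite pnatr_eq0 -lt0n.
have xiX k : xi R b ^+ k = cos (2 * pi / b%:R *+ k) +i* sin (2 * pi / b%:R *+ k).
  by rewrite /xi /cexp /= expR0 mul1r cos_sin_expr.
(* Among the exponents 1, ..., b, only b may give the value 1. *)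
apply/andP; split=> //; apply/forallP => i; rewrite unity_rootE xiX.
apply/eqP; case: (eqVneq i.+1 b) => [->|ib].
  rewrite -mulr_natr divfK // mulrC mulr_natr cos2pi -(add0r (pi *+ 2)).
  by rewrite sinD2pi sin0 eqxx.
have {}ib : (i.+1 < b)%N by rewrite ltn_neqAle ib ltn_ord.
(* Half the argument of the power. It lies strictly between 0 and pi, so sin y > 0 and the real part
   cos(2y) = 1 - 2 sin(y)^2 already differs from 1. *)
set y : R := pi / b%:R *+ i.+1.
have -> : 2 * pi / b%:R *+ i.+1 = y *+ 2.
  by rewrite -mulrA mulr_natl mulrnAC.
have sy : 0 < sin y.
  apply: sin_gt0_pi; rewrite /y -mulr_natr -mulrA pmulr_rgt0 ?pi_gt0 //.
  rewrite mulr_gt0 ?invr_gt0 ?ltr0n //= gtr_pMr ?pi_gt0 //.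
  by rewrite mulrC ltr_pdivrMr ?ltr0n // mul1r ltr_nat.
apply/negbTE; rewrite eq_complex /= negb_and cos_mulr2n cos2sin2.
rewrite mulrnBl addrAC -[1 *+ 2]/(1 + 1) addrK -subr_eq0 addrAC subrr add0r.
by rewrite oppr_eq0 mulrn_eq0 /= expf_eq0 /= gt_eqF.
Qed.

Lemma fdsum_nilE (R : realType) (b : nat) (t : int) :
  (0 < b)%N -> fdsum R [::] b t = deltaZ (t%:~R / b%:R : R) - b%:R^-1.
Proof.
move=> b0; have bR (A : numDomainType) : (b%:R : A) != 0.
  by rewrite pnatr_eq0 -lt0n.
(* The full geometric sum includes j = 0, whose term is 1; removing it produces the - 1/b. *)
have := sum_prim_root_expz _ b _ t (prim_root_xi R b b0).
rewrite big_ltn // mul0r expr0z => /(canRL (addKr _)) sumE.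
rewrite /fdsum; under eq_bigr do rewrite big_nil divr1.
rewrite sumE /deltaZ.
have -> : ((t%:~R / b%:R : R) \is a Num.int) = (b%:Z %| t)%Z.
  apply/intrP/dvdzP => -[q qE]; exists q.
    by apply/eqP; rewrite -(eqr_int R) intrM -qE divfK //; exact: bR.
  by rewrite qE intrM mulfK //; exact: bR.
case: ifP => _; last by rewrite addr0 sub0r mulrN1.
by rewrite mulrDr mulVf ?mulrN1 1?addrC //; exact: bR.
Qed.

Theorem theorem28 (R : realType) (b d : nat) (a : (d.-1).-tuple nat)
    (hb : (3 <= b)%N) (hd : (1 <= d)%N)
    (ha : forall i : 'I_d.-1, (0 < tnth a i)%N /\ coprime (tnth a i) b)
    (t : int) :
  [/\ (totient b)%:R^-1 *
        (\sum_(1 <= m < b | coprime m b) fdsum R (rcons a m) b t)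
      = 2^-1 * fdsum R a b t,
      ((totient b)%:R^-1) ^+ d *
        (\sum_(m : d.-tuple 'I_b
              | [forall i, (1 <= tnth m i)%N && coprime (tnth m i) b])
            fdsum R [seq nat_of_ord x | x <- m] b t)
      = (2 ^+ d)^-1 * fdsum R [::] b t
    & (2 ^+ d)^-1 * fdsum R [::] b t
      = (deltaZ (t%:~R / b%:R : R) - b%:R^-1) / 2 ^+ d].
Proof.
have b1 : (1 < b)%N by apply: ltnW.
have b0 : (0 < b)%N by apply: ltnW.
have xiP := prim_root_xi R b b0.
have phi0 : ((totient b)%:R : R[i]) != 0.
  by rewrite pnatr_eq0 -lt0n totient_gt0.
have two0 : (2 : R[i]) != 0 by rewrite pnatr_eq0.
(* The value 1/2 is the same for every j in range, so it can be pulled out of the sum over j. *)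
have avg j : (1 <= j < b)%N ->
    (totient b)%:R^-1 * \sum_(1 <= m < b | coprime m b)
      (1 - xi R b ^+ (j * m))^-1 = 2^-1.
  case/andP=> j0 jb; apply: (mulfI phi0); rewrite mulVKf //.
  apply: (mulIf two0); rewrite divfK // mulr_natr.
  by apply: sum_inv_coprime => //; rewrite gtnNdvd.
split; last by rewrite fdsum_nilE // mulrC.
(* For fixed j, only the last factor depends on m, so it alone is averaged. *)
- rewrite /fdsum -mulr_sumr exchange_big /= mulrCA [RHS]mulrCA; congr (_ * _).
  rewrite !mulr_sumr; apply: eq_big_nat => j jb; rewrite -(avg j jb) -mulrA.
  congr (_ * _); rewrite mulr_suml; apply: eq_bigr => m _.
  by rewrite big_rcons /= invfM mulrA mulrC.
(* For fixed j, the sum over tuples is the d-th power of a sum over one index, and each factor takes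
   one 1/phi(b). *)
- rewrite /fdsum -mulr_sumr exchange_big /= mulrCA [RHS]mulrCA; congr (_ * _).
  rewrite !mulr_sumr; apply: eq_big_nat => j jb.
  rewrite big_nil divr1 -exprVn -(avg j jb) exprMn -mulrA; congr (_ * _).
  rewrite -mulr_sumr mulrC; congr (_ * _).
  under eq_bigr do rewrite big_map -prodfV.
  rewrite (sum_tuple_prod _ _ d (fun x : 'I_b => (1 <= x)%N && coprime x b)
    (fun x : 'I_b => (1 - xi R b ^+ (j * x))^-1)).
  congr (_ ^+ _); rewrite big_geq_mkord /=.
  by apply: eq_bigl => x; rewrite andbC.
Qed.
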